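(* Let $f$ satisfy Assumption A with constant $b>0$, let $(\chi_n)_{n\ge 1}$ satisfy Assumption B, let $x_0>0$ be an arbitrary initial value, let $x^*\in (f(0),f(b))$ be an arbitrary point, and let $\nu=\nu(x^* )=\Phi(f^{-1}(x^* ))$. Then for each $\varepsilon>0$ and $\gamma\in(0,1)$ there exists $d>0$ such that for every $\ell$ with $0<\ell\le d$ there is a nonrandom $N=N(\gamma,x_0,\ell,x^*,\varepsilon)\in\mathbb N$ such that the solution $(x_n)$ of $$x_{n+1}=\max\{f(\nu x_n)+\ell\chi_{n+1},\,0\},\qquad n=0,1,2,\dots,$$ with initial value $x_0$ satisfies $$\mathbb P\{x_n\in(x^*-\varepsilon,x^*+\varepsilon)\ \text{ for all } n\ge N\}\ge\gamma.$$
   Context: Assumption A (on $f$ and $b$): $f:[0,\infty)\to[0,\infty)$ is continuous, and $b>0$ is a real number such that $f$ is strictly increasing on $(0,b]$, $f(x)/x$ is strictly decreasing on $(0,b]$, $f(b)>b$, and $f(b)/b>f(x)/x$ for all $x\in(b,\infty)$. Assumption B (on the noise): on a complete probability space $(\Omega,\mathcal F,\mathbb P)$, $(\chi_n)_{n\ge1}$ is a sequence of independent identically distributed random variables with zero mean, having a density $\phi$ with $\phi(x)>0$ for $x\in[-1,1]$ and $\phi(x)=0$ for $x\notin[-1,1]$. Notation: $f^{-1}:[f(0),f(b)]\to[0,b]$ is the inverse of the restriction of $f$ to $[0,b]$. $\Phi(z):=z/f(z)$ for $z\in(0,b]$. *)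

(* Defs.v *)
From HB Require Import structures.
From mathcomp Require Import all_boot all_order all_algebra.
From mathcomp Require Import all_classical all_reals all_analysis.

Set Implicit Arguments.
Unset Strict Implicit.
Unset Printing Implicit Defensive.

Import Order.TTheory GRing.Theory Num.Theory.
Import numFieldNormedType.Exports.

Local Open Scope classical_set_scope.
Local Open Scope ring_scope.

(* A map [0, +oo) -> [0, +oo) is represented by a total f : R -> R, constrained
   on [0, +oo) only; its values at negative arguments are irrelevant. *)
Record assumption_A (R : realType) (f : R -> R) (b : R) : Prop := AssumptionA {
  f_ge0 : forall x, 0 <= x -> 0 <= f x ;
  f_continuous : {within `[0, +oo[, continuous f} ;
  b_gt0 : 0 < b ;
  f_increasing : {in `]0, b] &, forall x y, x < y -> f x < f y} ;
  f_div_decreasing : {in `]0, b] &, forall x y, x < y -> f y / y < f x / x} ;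
  f_b_gt : b < f b ;
  f_b_div_gt : forall x, b < x -> f x / x < f b / b }.

(* The partial inverse over [0, b]: a two-sided inverse between [0, b] and
   f([0, b]) when f is injective on [0, b]. *)
Definition f_inv (R : realType) (f : R -> R) (b : R) : R -> R :=
  'pinv_(fun=> 0) `[0, b] f.

Definition Phi (R : realType) (f : R -> R) (z : R) : R := z / f z.

Definition mutually_independent (d : measure_display) (T : measurableType d)
    (R : realType) (P : probability T R) (I : choiceType) (D : set I)
    (X : I -> {RV P >-> R}) : Prop :=
  forall (s : seq I) (B : I -> set R),
    uniq s -> [set` s] `<=` D -> (forall i, measurable (B i)) ->
    (P (\bigcap_(i in [set` s]) (X i @^-1` B i)) =
     \prod_(i <- s) P (X i @^-1` B i))%E.

Definition has_density (d : measure_display) (T : measurableType d)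
    (R : realType) (P : probability T R) (X : {RV P >-> R}) (phi : R -> R)
    : Prop :=
  [/\ measurable_fun [set: R] phi, (forall x, 0 <= phi x) &
      forall A : set R, measurable A ->
        distribution P X A = (\int[lebesgue_measure]_(x in A) (phi x)%:E)%E].

(* The noise is indexed from 1: chi 0 is unconstrained, and never used. *)
Record assumption_B (d : measure_display) (T : measurableType d)
    (R : realType) (P : probability T R) (chi : nat -> {RV P >-> R})
    (phi : R -> R) : Prop := AssumptionB {
  P_complete : measure_is_complete P ;
  chi_independent : mutually_independent [set n | (0 < n)%N] chi ;
  chi_identically_distributed : forall m n, (0 < m)%N -> (0 < n)%N ->
    forall A : set R, measurable A ->
      distribution P (chi m) A = distribution P (chi n) A ;
  chi_mean0 : forall n, (0 < n)%N -> ('E_P[chi n] = 0)%E ;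
  chi_density : forall n, (0 < n)%N -> has_density (chi n) phi ;
  phi_gt0 : forall x, x \in `[-1, 1] -> 0 < phi x ;
  phi_eq0 : forall x, x \notin `[-1, 1] -> phi x = 0 }.

Fixpoint solution (R : realType) (T : Type) (f : R -> R) (nu l : R)
    (chi : nat -> T -> R) (x0 : R) (n : nat) (w : T) : R :=
  if n is m.+1 then
    Num.max (f (nu * solution f nu l chi x0 m w) + l * chi m.+1 w) 0
  else x0.

(* Main.v *)
(** Write g y = f (nu y).  Then g xstar = xstar, g lies above the diagonal on
    ]0, xstar[ and below it beyond xstar, and g is increasing near xstar.  Take
    a < xstar < c close to xstar.  For a small noise level l:
    - [a, c] is mapped by g at distance at least l inside itself, so the
      perturbed orbit never leaves it;
    - above c the orbit decreases by a fixed amount whatever the noise is, and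
      g maps [0, c] below c - l, so after a deterministic time n0 the orbit
      stays in [0, c];
    - below a one has g y >= y, so K consecutive noise values in [1/2, 1] with
      K l / 2 >= a lift the orbit into [a, c].
    The disjoint noise blocks of length K after n0 are independent, each having
    all its values in [1/2, 1] with probability p ^ K > 0; hence none of the
    first J blocks does with probability (1 - p ^ K) ^ J, which tends to 0. *)
Require Import Defs.
From mathcomp Require Import all_boot all_order all_algebra.
From mathcomp Require Import all_classical all_reals all_analysis.
From mathcomp Require Import measurable_realfun zify ring lra.
Import Order.TTheory GRing.Theory Num.Theory.
Import numFieldNormedType.Exports.
Local Open Scope classical_set_scope.
Local Open Scope ring_scope.

(** * Deterministic bounds for perturbed orbits *)

Lemma perturbation_bounds {R : realType} (l u : R) :
  0 < l -> -1 <= u <= 1 -> - l <= l * u <= l.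
Proof. by move=> l0 /andP[u1 u2]; apply/andP; split; nra. Qed.

(** The maximum merges two phases into one induction: a loss of at least [delta] per step while the
    orbit is above [c], then the bound [c], which the margin [l] preserves. *)
Lemma perturbed_orbit_le {R : realType} {g : R -> R} {x u : nat -> R}
    {c l delta : R} :
  0 < c -> 0 < l ->
  (forall y, 0 <= y <= c -> g y <= c - l) ->
  (forall y, c < y -> g y <= y - delta - l) ->
  (forall n, 0 <= x n) ->
  (forall n, x n.+1 = Num.max (g (x n) + l * u n.+1) 0) ->
  (forall n, -1 <= u n.+1 <= 1) ->
  forall n, x n <= Num.max c (x 0%N - n%:R * delta).
Proof.
move=> c0 l0 gc gd x_ge0 xE u1; elim=> [|n IH].
  by rewrite mul0r subr0 le_max lexx orbT.
have /andP[_ lu] := perturbation_bounds _ _ l0 (u1 n).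
rewrite xE ge_max [X in _ && X]le_max (ltW c0) andbT.
have [xc|cx] := leP (x n) c.
  have := gc (x n); rewrite x_ge0 xc => /(_ isT) gx.
  by rewrite le_max; apply/orP; left; lra.
have := gd _ cx; move: IH; rewrite !le_max leNgt cx /= => IH gx.
by apply/orP; right; rewrite -natr1; lra.
Qed.

Lemma perturbed_orbit_trapped {R : realType} {g : R -> R} {x u : nat -> R}
    {a c l : R} :
  0 < l ->
  (forall y, a <= y <= c -> a + l <= g y <= c - l) ->
  (forall n, x n.+1 = Num.max (g (x n) + l * u n.+1) 0) ->
  (forall n, -1 <= u n.+1 <= 1) ->
  0 <= c ->
  forall m, a <= x m <= c -> forall n, (m <= n)%N -> a <= x n <= c.
Proof.
move=> l0 gac xE u1 c0 m xm n; elim: n => [|n IH].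
  by rewrite leqn0 => /eqP <-.
rewrite leq_eqVlt => /predU1P[<- //|]; rewrite ltnS => /IH /gac /andP[ga gc].
have /andP[lu1 lu2] := perturbation_bounds _ _ l0 (u1 n).
rewrite xE le_max ge_max c0 andbT.
by apply/andP; split; [apply/orP; left|]; lra.
Qed.

(** Below [a] each step gains at least [l / 2]. The minimum with [a] lets the induction go on when
    the orbit gets there early. *)
Lemma perturbed_orbit_climb {R : realType} {g : R -> R} {x u : nat -> R}
    {a c l : R} {m K : nat} :
  0 < l ->
  (forall y, 0 <= y < a -> y <= g y) ->
  (forall y, a <= y <= c -> a + l <= g y) ->
  (forall n, x n.+1 = Num.max (g (x n) + l * u n.+1) 0) ->
  (forall n, 0 <= x n) ->
  (forall n, (m <= n)%N -> x n <= c) ->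
  (forall i, (i < K)%N -> 2^-1 <= u (m + i).+1) ->
  forall i, (i <= K)%N -> Num.min a (i%:R * (l / 2)) <= x (m + i)%N.
Proof.
move=> l0 g_ge gac xE x_ge0 xc u_half; elim=> [_|i IH iK].
  by rewrite mul0r ge_min x_ge0 orbT.
rewrite addnS xE le_max; apply/orP; left.
have lu : l / 2 <= l * u (m + i).+1 by rewrite ler_pM2l // u_half.
have l2 : 0 < l / 2 by lra.
have [xa|ax] := ltP (x (m + i)%N) a.
  have := IH (ltnW iK); rewrite !ge_min leNgt xa /= => IHi.
  have := g_ge (x (m + i)%N); rewrite x_ge0 xa => /(_ isT) gx.
  by apply/orP; right; rewrite -natr1; lra.
have := gac (x (m + i)%N); rewrite ax xc ?leq_addr // => /(_ isT) gx.
by rewrite ge_min; apply/orP; left; lra.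
Qed.

Lemma solution_ge0 {R : realType} {T : Type} (f : R -> R) (nu l : R)
    (chi : nat -> T -> R) (x0 : R) (w : T) (n : nat) :
  0 <= x0 -> 0 <= solution f nu l chi x0 n w.
Proof. by case: n => [//|n] _ /=; rewrite le_max lexx orbT. Qed.

(** * The controlled map and its fixed point *)

Lemma f_inv_spec {R : realType} {f : R -> R} {b xstar : R} :
  assumption_A f b -> xstar \in `]f 0, f b[ ->
  0 < f_inv f b xstar < b /\ f (f_inv f b xstar) = xstar.
Proof.
move=> hA; rewrite in_itv /= => /andP[f0x xfb].
have b0 := b_gt0 hA.
have [y y0b fy] : exists2 y, y \in `[0, b] & f y = xstar.
  apply: IVT; first exact: ltW.
    apply: continuous_subspaceW (f_continuous hA) => y /=.
    by rewrite !in_itv /= andbT => /andP[].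
  by rewrite ge_min le_max (ltW f0x) (ltW xfb) orbT.
have xim : [set f z | z in `[0, b]%classic] xstar by exists y.
have fK : f (f_inv f b xstar) = xstar by rewrite /f_inv pinvK // inE.
have : `[0, b]%classic (f_inv f b xstar).
  apply: (@surjpinv_image_sub _ _ (fun=> 0) _ _ f (fun _ h => h)).
  by exists xstar.
rewrite /= in_itv /= !le_eqVlt => /andP[/predU1P[z0|z_gt0]].
  by rewrite -fK -z0 ltxx in f0x.
move=> /predU1P[zb|z_ltb]; first by rewrite -fK zb ltxx in xfb.
by rewrite z_gt0 z_ltb.
Qed.

(** When [z] lies beyond [b], the ratio [f b / b] separates the two sides. *)
Lemma f_div_lt {R : realType} {f : R -> R} {b y z : R} :
  assumption_A f b -> 0 < y -> y <= b -> y < z -> f z / z < f y / y.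
Proof.
move=> hA y0 yb yz; have z0 := lt_trans y0 yz.
have [zb|bz] := leP z b.
  by apply: (f_div_decreasing hA); rewrite ?in_itv /= ?y0 ?z0.
apply: lt_le_trans (f_b_div_gt hA bz) _.
have [-> //|yneb] := eqVneq y b.
have ltyb : y < b by rewrite lt_neqAle yneb.
apply/ltW/(f_div_decreasing hA) => //; first by rewrite in_itv /= y0.
by rewrite in_itv /= (b_gt0 hA) lexx.
Qed.

(** The control is chosen so that [nu * xstar = f_inv f b xstar], a point which [f] sends to
    [xstar]. *)
Lemma controlled_map_fixpoint {R : realType} {f : R -> R} {b xstar : R} :
  assumption_A f b -> xstar \in `]f 0, f b[ ->
  let nu := Phi f (f_inv f b xstar) in
  [/\ 0 < xstar, 0 < nu, nu * xstar < b & f (nu * xstar) = xstar].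
Proof.
move=> hA hx /=; have [/andP[y0 yb] fy] := f_inv_spec hA hx.
have x0 : 0 < xstar.
  move: hx; rewrite in_itv /= => /andP[+ _]; apply: le_lt_trans.
  exact: (f_ge0 hA).
rewrite /Phi fy divfK ?gt_eqF //; split=> //.
by rewrite divr_gt0.
Qed.

Lemma controlled_map_div_lt {R : realType} {f : R -> R} {b nu y z : R} :
  assumption_A f b -> 0 < nu -> 0 < y -> nu * y <= b -> y < z ->
  f (nu * z) / z < f (nu * y) / y.
Proof.
move=> hA nu0 y0 nyb yz.
have E t : f (nu * t) / t = nu * (f (nu * t) / (nu * t)).
  by rewrite invfM mulrCA mulVKf // gt_eqF.
by rewrite E [ltRHS]E ltr_pM2l // (f_div_lt hA) ?mulr_gt0 // ltr_pM2l.
Qed.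

Lemma controlled_map_interval {R : realType} {f : R -> R} {b nu xstar eps : R} :
  assumption_A f b -> f 0 < xstar -> 0 < nu -> 0 < xstar -> nu * xstar < b ->
  f (nu * xstar) = xstar -> 0 < eps ->
  exists a c l0 delta : R,
    [/\ 0 < a, xstar - eps < a, a <= c < xstar + eps, 0 < l0 & 0 < delta] /\
  forall l, 0 < l <= l0 ->
    [/\ forall y, 0 <= y < a -> y <= f (nu * y),
        forall y, a <= y <= c -> a + l <= f (nu * y),
        forall y, 0 <= y <= c -> f (nu * y) <= c - l
      & forall y, c < y -> f (nu * y) <= y - delta - l].
Proof.
move=> hA f0x nu0 x0 nxb fx eps0.
(* The three terms keep the interval inside the [eps]-window, keep [a] positive, and keep [nu * c]
   at most [b], where [f] is still increasing. *)
pose e := Num.min (eps / 2) (Num.min (xstar / 2) ((b - nu * xstar) / nu)).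
have e0 : 0 < e by rewrite !lt_min !divr_gt0 // subr_gt0.
have [e1 e2 e3] : [/\ e <= eps / 2, e <= xstar / 2 & nu * e <= b - nu * xstar].
  split; rewrite ?ge_min ?lexx ?orbT //.
  by rewrite mulrC -ler_pdivlMr // !ge_min lexx !orbT.
pose a := xstar - e; pose c := xstar + e.
have [a0 ax xc] : [/\ 0 < a, a < xstar & xstar < c].
  by rewrite /a /c; split; lra.
have c0 : 0 < c by lra.
have ncb : nu * c <= b by rewrite mulrDr; lra.
have mon y z : 0 < y -> y <= z -> z <= c -> f (nu * y) <= f (nu * z).
  move=> y0; rewrite le_eqVlt => /predU1P[-> //|yz zc].
  have z0 := lt_trans y0 yz.
  have nzb : nu * z <= b by apply: le_trans ncb; rewrite ler_pM2l.
  apply/ltW/(f_increasing hA); rewrite ?in_itv /= ?mulr_gt0 ?ltr_pM2l //.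
  by apply: le_trans nzb; rewrite ler_pM2l // ltW.
have above y : 0 < y -> y < xstar -> y < f (nu * y).
  move=> y0 yx; have nyb : nu * y <= b.
    by apply/ltW/(lt_trans _ nxb); rewrite ltr_pM2l.
  have := controlled_map_div_lt hA nu0 y0 nyb yx.
  by rewrite fx mulfV ?gt_eqF // ltr_pdivlMr // mul1r.
have below : f (nu * c) < c.
  have := controlled_map_div_lt hA nu0 x0 (ltW nxb) xc.
  by rewrite fx mulfV ?gt_eqF // ltr_pdivrMr // mul1r.
have ga := above a a0 ax.
(* The gap at [c] is halved: one half absorbs the noise, the other is the guaranteed descent
   [delta]. *)
exists a, c, (Num.min (f (nu * a) - a) ((c - f (nu * c)) / 2)),
  ((c - f (nu * c)) / 2).
split.
  split; [by [] | by rewrite /a; lra | | | by lra].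
    by rewrite /c; apply/andP; split; lra.
  by rewrite lt_min; apply/andP; split; lra.
move=> l; rewrite le_min => /and3P[l0 l1 l2]; split.
- move=> y /andP[]; rewrite le_eqVlt => /predU1P[<- _|y0 ya].
    by rewrite mulr0; apply: (f_ge0 hA).
  by apply/ltW/above => //; lra.
- by move=> y /andP[ay yc]; have := mon a y a0 ay yc; lra.
- move=> y /andP[]; rewrite le_eqVlt => /predU1P[<- _|y0 yc].
(* Monotonicity is assumed only on []0, b]], so the value at 0 is bounded through [f 0 < xstar]. *)
have := mon xstar c x0 (ltW xc) (lexx _); rewrite mulr0 fx. lra.
  by have := mon y c y0 yc (lexx _); lra.
- move=> y cy; have y0 := lt_trans c0 cy.
  have := controlled_map_div_lt hA nu0 c0 ncb cy.
  rewrite ltr_pdivrMr // => gy.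
  (* Beyond [c] the map lies under the line through the origin of slope [f (nu * c) / c]. As this
     slope is at most 1, the gap to the diagonal is at least the gap at [c]. *)
  have q1 : f (nu * c) / c <= 1 by rewrite ler_pdivrMr // mul1r ltW.
  have qc : f (nu * c) / c * c = f (nu * c) by rewrite divfK // gt_eqF.
  suff : f (nu * c) / c * y <= f (nu * c) + (y - c) by lra.
  by rewrite -{2}qc; nra.
Qed.

(** * Measurability, densities and independent noise blocks *)

Lemma measurable_solution {R : realType} {d : measure_display}
    {T : measurableType d} {f : R -> R} {nu l x0 : R} {chi : nat -> T -> R} :
  {within `[0, +oo[, continuous f} -> 0 <= nu -> 0 <= x0 ->
  (forall n, measurable_fun [set: T] (chi n)) ->
  forall n, measurable_fun [set: T] (solution f nu l chi x0 n).
Proof.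
move=> fc nu0 x0_ge0 mchi; elim=> [|n IH]; first exact: measurable_cst.
have mf : measurable_fun [set: T]
    (f \o (fun w => nu * solution f nu l chi x0 n w)).
  (* Continuity of [f] is known only on [[0, +oo[], so the composition goes through that set. *)
  apply: (@measurable_comp _ _ _ T (measurableTypeR R) (measurableTypeR R)
    `[0, +oo[%classic).
  - exact: measurable_itv.
  - move=> _ [w _ <-]; rewrite /= in_itv /= andbT mulr_ge0 //.
    exact: solution_ge0.
  - exact: subspace_continuous_measurable_fun.
  - exact: measurable_funM.
apply: measurable_maxr => //; apply: measurable_funD; first exact: mf.
exact: measurable_funM.
Qed.

(** A zero integral would force [phi] to vanish almost everywhere on [A], hence [A] to be null. *)
Lemma density_gt0_prob_gt0 {d : measure_display} {T : measurableType d}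
    {R : realType} {P : probability T R} {X : {RV P >-> R}} {phi : R -> R}
    {A : set R} :
  has_density X phi -> measurable A -> (0 < lebesgue_measure A)%E ->
  (forall x, A x -> 0 < phi x) -> (0 < P (X @^-1` A))%E.
Proof.
move=> [mphi phi_ge0 XE] mA A0 phi_gt0.
have mphiA : measurable_fun A (EFin \o phi).
  by apply/measurable_EFinP; apply: measurable_funS mphi.
rewrite lt0e measure_ge0 andbT; apply/negP => /eqP PA0.
have int0 : (\int[lebesgue_measure]_(x in A) `|(EFin \o phi) x| = 0)%E.
  rewrite -PA0.
  have -> : P (X @^-1` A) = (\int[lebesgue_measure]_(x in A) (phi x)%:E)%E.
    exact: XE.
  by apply: eq_integral => x _ /=; rewrite ger0_norm.
have [N [mN N0 AN]] :=
  proj1 (ae_eq_integral_abs lebesgue_measure mA mphiA) int0.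
have : (lebesgue_measure A <= lebesgue_measure N)%E.
  apply: le_measure; rewrite ?inE //.
  apply: subset_trans AN => x Ax /= /(_ Ax) [phix0].
  by have := phi_gt0 x Ax; rewrite phix0 ltxx.
by rewrite N0 leNgt A0.
Qed.

Lemma density_eq0_prob_eq0 {d : measure_display} {T : measurableType d}
    {R : realType} {P : probability T R} {X : {RV P >-> R}} {phi : R -> R}
    {A : set R} :
  has_density X phi -> measurable A -> (forall x, A x -> phi x = 0) ->
  P (X @^-1` A) = 0%E.
Proof.
move=> [_ _ XE] mA phi0; have -> := XE A mA : P (X @^-1` A) = _.
by apply: integral0_eq => x Ax; rewrite phi0.
Qed.

(* The extra indices [t] make the induction on [J] go through: the event for
   [J.+1] is a difference of two events for [J]. *)
Lemma prob_no_full_block {d : measure_display} {T : measurableType d}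
    {R : realType} {P : probability T R} {chi : nat -> {RV P >-> R}}
    {B : set R} {p : R} {n0 K : nat} :
  mutually_independent [set n | (0 < n)%N] chi -> measurable B ->
  (forall n, (0 < n)%N -> P (chi n @^-1` B) = p%:E) ->
  forall J (t : seq nat), uniq t ->
    (forall i, i \in t -> (n0 + J * K < i)%N) ->
  P (\bigcap_(i in [set` t]) (chi i @^-1` B) `&`
     \bigcap_(j < J)
       ~` \bigcap_(i in [set` iota (n0 + j * K).+1 K]) (chi i @^-1` B)) =
  (p ^+ size t * (1 - p ^+ K) ^+ J)%:E.
Proof.
move=> indep mB Bp.
have mchi i : measurable (chi i @^-1` B) by exact: measurable_funPTI.
have mall (t : seq nat) : measurable (\bigcap_(i in [set` t]) (chi i @^-1` B)).
  rewrite bigcap_seq. apply: bigsetI_measurable => //.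
elim=> [|J IH] t ut ht.
  rewrite II0 bigcap_set0 setIT.
  rewrite indep // => [|i /ht]; last exact: leq_ltn_trans.
  rewrite expr0 mulr1 (eq_big_seq (fun=> p%:E)) => [|i /ht ti]; last first.
    by rewrite Bp // (leq_ltn_trans _ ti).
  by rewrite prodEFin big_const_seq count_predT iter_mulr_1.
(* The block numbered [J]. Its indices start one later than time [n0 + J * K] because [chi n.+1]
   drives the step from [n] to [n.+1]. *)
set b := iota (n0 + J * K).+1 K.
have bE i : (i \in b) = (n0 + J * K < i <= n0 + J.+1 * K)%N.
  by rewrite mem_iota mulSn [(K + _)%N]addnC addnA addSn ltnS.
have tb i : i \in t -> (n0 + J * K < i)%N.
  by move=> /ht; apply: leq_ltn_trans; rewrite leq_add2l leq_mul2r leqnSn orbT.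
have IHt := IH t ut tb.
have := IH (b ++ t); rewrite cat_uniq iota_uniq ut andbT /= size_cat size_iota.
move=> /(_ _ _)/wrap[].
  by apply/hasPn => i /ht ti; rewrite bE [(i <= _)%N]leqNgt ti andbF.
  by move=> i; rewrite mem_cat bE => /orP[/andP[]//|/tb].
rewrite bigcap_seq big_cat -!bigcap_seq => IHbt.
rewrite IIS bigcap_setU bigcap_set1 setIA -setDE measureD //.
- rewrite setIAC [_ `&` \bigcap_(i in [set` b]) _]setIC.
  rewrite [X in (X - _)%E]IHt [X in (_ - X)%E]IHbt -EFinB.
  by congr EFin; rewrite exprD exprS; ring.
- apply: measurableI => //; case: J {IH b bE ht tb IHt IHbt} => [|J].
    by rewrite II0 bigcap_set0.
  apply: bigcap_measurable; first by exists 0%N.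
  by move=> j _; apply: measurableC.
- by rewrite [X in (X < _)%E]IHt ltry.
Qed.

(** * Capture of a single orbit *)

Lemma perturbed_orbit_captured {R : realType} {g : R -> R} {x u : nat -> R}
    {a c l delta : R} {n0 J K : nat} :
  0 < a -> a <= c -> 0 < l -> 0 < delta ->
  (forall y, 0 <= y < a -> y <= g y) ->
  (forall y, a <= y <= c -> a + l <= g y) ->
  (forall y, 0 <= y <= c -> g y <= c - l) ->
  (forall y, c < y -> g y <= y - delta - l) ->
  (forall n, 0 <= x n) ->
  (forall n, x n.+1 = Num.max (g (x n) + l * u n.+1) 0) ->
  (forall n, -1 <= u n.+1 <= 1) ->
  x 0%N <= n0%:R * delta -> a <= K%:R * (l / 2) ->
  (exists2 j, (j < J)%N &
    forall i, i \in iota (n0 + j * K).+1 K -> 2^-1 <= u i) ->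
  forall n, (n0 + J * K <= n)%N -> a <= x n <= c.
Proof.
move=> a0 ac l0 delta0 g_ge g_up g_le g_down x_ge0 xE u1 n0P KP [j jJ uj] n nJ.
have c0 : 0 < c := lt_le_trans a0 ac.
have xc m : (n0 <= m)%N -> x m <= c.
  move=> n0m; have := perturbed_orbit_le c0 l0 g_le g_down x_ge0 xE u1 m.
  have : n0%:R * delta <= m%:R * delta by rewrite ler_pM2r // ler_nat.
  by rewrite le_max => n0m_delta /orP[//|xm]; lra.
have jn0 : (n0 <= n0 + j * K)%N by rewrite leq_addr.
have u_half i : (i < K)%N -> 2^-1 <= u (n0 + j * K + i).+1.
  by move=> iK; apply: uj; rewrite mem_iota; apply/andP; split; lia.
have := perturbed_orbit_climb l0 g_ge g_up xE x_ge0
  (fun m jm => xc m (leq_trans jn0 jm)) u_half K (leqnn K).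
rewrite min_l // => ax.
have gac y : a <= y <= c -> a + l <= g y <= c - l.
  move=> yac; rewrite g_up // g_le //; case/andP: yac => ay ->.
  by rewrite (le_trans (ltW a0)).
(* At the end of block [j] the orbit is in the trap; since [j < J], this is no later than
   [n0 + J * K]. *)
apply: (perturbed_orbit_trapped l0 gac xE u1 (ltW c0)
  (n0 + j * K + K)%N); last by nia.
by rewrite ax xc // -addnA leq_addr.
Qed.

(** * Choice of constants and bounds on the noise *)

Lemma exprn_lt_eventually {R : realType} (q e : R) :
  0 <= q < 1 -> 0 < e -> exists n, q ^+ n < e.
Proof.
move=> /andP[q0 q1] e0.
have : \forall n \near \oo, q ^+ n < e.
  by apply: (cvgr_lt 0) => //; apply: cvg_expr; rewrite ger0_norm.
by case=> n _ /(_ n (leqnn n)); exists n.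
Qed.

Lemma exists_natmul_ge {R : realType} (x e : R) :
  0 < e -> exists n, x <= n%:R * e.
Proof.
move=> e0; exists (Num.bound `|x / e|).
rewrite -ler_pdivrMr //.
exact/ltW/(le_lt_trans (ler_norm _))/archi_boundP.
Qed.

Lemma assumption_B_half {d : measure_display} {T : measurableType d}
    {R : realType} {P : probability T R} {chi : nat -> {RV P >-> R}}
    {phi : R -> R} :
  assumption_B chi phi ->
  exists p : R, 0 < p <= 1 /\
    forall n, (0 < n)%N -> P (chi n @^-1` `[2^-1, 1]) = p%:E.
Proof.
move=> hB.
have mA : measurable (`[2^-1, 1]%classic : set R) by exact: measurable_itv.
have A0 : (0 < @lebesgue_measure R `[2^-1%R, 1%R]%classic)%E.
  by rewrite lebesgue_measure_itv /= lte_fin ifT -?EFinB ?lte_fin; lra.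
have m1 : measurable (chi 1%N @^-1` `[2^-1, 1]) by exact: measurable_funPTI.
have P1 := probability_le1 P m1.
have P0 : (0 < P (chi 1%N @^-1` `[2^-1%R, 1%R]))%E.
  apply: (density_gt0_prob_gt0 (chi_density hB _) mA A0) => // x.
  rewrite /= in_itv /= => /andP[x2 x1]; apply: (phi_gt0 hB).
  by rewrite in_itv /= x1 andbT; lra.
have Pfin : P (chi 1%N @^-1` `[2^-1, 1]) \is a fin_num.
  by rewrite fin_num_measure.
exists (fine (P (chi 1%N @^-1` `[2^-1, 1]))); split.
  by rewrite -lte_fin -lee_fin fineK // P0.
by move=> n n_gt0; rewrite fineK //; apply: (chi_identically_distributed hB).
Qed.

(** One null event collects all exceptional noise values, so that the pathwise lemmas apply outside
    it. The shift skips [chi 0]. *)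
Lemma assumption_B_bounded {d : measure_display} {T : measurableType d}
    {R : realType} {P : probability T R} {chi : nat -> {RV P >-> R}}
    {phi : R -> R} :
  assumption_B chi phi ->
  measurable (\bigcup_n (chi n.+1 @^-1` ~` `[-1, 1])) /\
  P (\bigcup_n (chi n.+1 @^-1` ~` `[-1, 1])) = 0%E.
Proof.
move=> hB.
have mC : measurable (~` `[-1, 1] : set R).
  by apply: measurableC; exact: measurable_itv.
have mF n : measurable (chi n.+1 @^-1` ~` `[-1, 1]) by exact: measurable_funPTI.
have mU : measurable (\bigcup_n (chi n.+1 @^-1` ~` `[-1, 1])).
  exact: bigcupT_measurable.
split=> //; apply/negligibleP => //; apply: negligible_bigcup => n.
apply/negligibleP => //; apply: (density_eq0_prob_eq0 (chi_density hB _)) => //.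
by move=> x /negP; apply: (phi_eq0 hB).
Qed.

Theorem theorem4p8 (R : realType) (d : measure_display)
    (Omega : measurableType d) (P : probability Omega R)
    (f : R -> R) (b : R) (hA : assumption_A f b)
    (chi : nat -> {RV P >-> R}) (phi : R -> R) (hB : assumption_B chi phi)
    (x0 : R) (hx0 : 0 < x0)
    (xstar : R) (hxstar : xstar \in `]f 0, f b[) :
  let nu := Phi f (f_inv f b xstar) in
  forall eps gamma : R, 0 < eps -> 0 < gamma < 1 ->
  exists2 dl : R, 0 < dl &
  forall l : R, 0 < l <= dl ->
  exists N : nat,
    (gamma%:E <=
     P [set w | forall n : nat, (N <= n)%N ->
          (solution f nu l chi x0 n w \in `]xstar - eps, xstar + eps[)%R])%E.
Proof.
move=> nu eps gamma eps0 /andP[gamma0 gamma1].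
have [xs0 nu0 nxb fx] := controlled_map_fixpoint hA hxstar.
have f0x : f 0 < xstar by move: hxstar; rewrite in_itv /= => /andP[].
have [a [c [l0 [delta [[a0 ea /andP[ac ce] l0_gt0 delta0] gP]]]]] :=
  controlled_map_interval hA f0x nu0 xs0 nxb fx eps0.
(* The threshold comes from the geometry of [f] alone; [gamma] enters only through [J], chosen after
   [l] and [K]. *)
exists l0 => // l /[dup] /andP[l_gt0 _] /gP[g_ge g_up g_le g_down].
have [p [/andP[p0 p1] pE]] := assumption_B_half hB.
have [n0 n0P] := exists_natmul_ge x0 delta delta0.
have [K KP] := exists_natmul_ge a (l / 2) (divr_gt0 l_gt0 (ltr0Sn _ 1)).
have [J JP] : exists J, (1 - p ^+ K) ^+ J < 1 - gamma.
  apply: exprn_lt_eventually; last by rewrite subr_gt0.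
  have pK0 := exprn_gt0 K p0; have pK1 := exprn_ile1 K (ltW p0) p1.
  by apply/andP; split; lra.
exists (n0 + J * K)%N; set S := [set w | _].
pose x n w := solution f nu l chi x0 n w.
have mx n : measurable_fun [set: Omega] (x n).
  apply: measurable_solution (f_continuous hA) (ltW nu0) (ltW hx0) _ n => m.
  exact: measurable_funPT.
have mS : measurable S.
  rewrite (_ : S = \bigcap_(n in [set n | (n0 + J * K <= n)%N])
    (x n @^-1` `]xstar - eps, xstar + eps[)); last first.
    by apply/seteqP; split => w /= Sw n; apply: Sw.
  apply: bigcap_measurable; first by exists (n0 + J * K)%N => /=.
  move=> n _; rewrite -[X in measurable X]setTI.
  exact: (mx n measurableT _ (measurable_itv _)).
pose Bad := \bigcup_n (chi n.+1 @^-1` ~` `[-1, 1]).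
pose block j :=
  \bigcap_(i in [set` iota (n0 + j * K).+1 K]) (chi i @^-1` `[2^-1, 1]).
pose D := \bigcap_(j < J) ~` block j.
have [mBad PBad] := assumption_B_bounded hB.
have mD : measurable D.
  rewrite /D bigcap_mkord; apply: bigsetI_measurable => j _; apply: measurableC.
  rewrite /block bigcap_seq; apply: bigsetI_measurable => i _.
  exact: measurable_funPTI.
have PD : P D = ((1 - p ^+ K) ^+ J)%:E.
  have := prob_no_full_block (n0 := n0) (K := K) (chi_independent hB)
    (measurable_itv `[2^-1, 1]) pE J [::] isT.
  by rewrite bigcap_seq big_nil setTI expr0 mul1r; apply.
(* Pathwise core: bounded noise and one full block among the first [J] force capture. *)
have SC : ~` S `<=` D `|` Bad.
  apply: subsetCl; rewrite setCU => w [nD nBad] n nN.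
  have u1 m : -1 <= chi m.+1 w <= 1.
    have [//|u1] := boolP (-1 <= chi m.+1 w <= 1); exfalso; apply: nBad.
    by exists m => //=; rewrite in_itv /=; apply/negP.
  have [j jJ jB] : exists2 j, (j < J)%N & block j w.
    apply: contrapT => nex; apply: nD => j jJ jw; apply: nex.
    by exists j.
  have x_ge0 m : 0 <= x m w by apply: solution_ge0; exact: ltW.
  have := perturbed_orbit_captured (g := fun y => f (nu * y))
    (x := fun m => x m w) (u := fun m => chi m w) a0 ac l_gt0 delta0 g_ge
    g_up g_le g_down x_ge0
    (fun=> erefl) u1 n0P KP.
  move=> /(_ J _ n nN)/wrap[|/andP[ax xc]]; last first.
    rewrite in_itv /=; apply/andP.
    by split; [exact: lt_le_trans ax|exact: le_lt_trans ce].
  exists j => // i ij; have := jB i ij.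
  by rewrite /= in_itv /= => /andP[].
have PSC : (P (~` S) <= ((1 - p ^+ K) ^+ J)%:E)%E.
  rewrite -PD -[leRHS]adde0 -PBad; apply: le_trans (measureU2 _ mD mBad).
  apply: le_measure; rewrite ?inE //; first exact: measurableC.
  exact: measurableU.
rewrite -[S]setCK probability_setC; last exact: measurableC.
apply: le_trans (leeB (lexx _) PSC).
by rewrite -EFinB lee_fin; lra.
Qed.
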